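(* Let $\{(N_k,B_k)\}_{k=1}^\infty$ be a sequence where, for every $k\ge 1$, $N_k\ge 2$ and $B_k\subseteq[0,+\infty)$ is finite and nonempty. Suppose that the infinite convolution $\mu(\boldsymbol{\omega})$ exists for every $\boldsymbol{\omega}\in\Omega$ and that $\Phi=\{\mu(\boldsymbol{\omega}):\boldsymbol{\omega}\in\Omega\}$ is tight. Then for every sequence $\mathbf{n}=\{n_k\}_{k=1}^\infty$ of positive integers, the mapping $\mu^{\mathbf{n}}:\Omega\times\mathcal{B}(\mathbb{R})\to[0,+\infty]$, $(\boldsymbol{\omega},B)\mapsto\mu^{\mathbf{n}}(\boldsymbol{\omega})(B)$, is a random measure on $(\mathbb{R},\mathcal{B}(\mathbb{R}))$ with respect to $(\Omega,\mathcal{F})$.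
   Context: $\Omega=\mathbb{N}^{\mathbb{N}}$ with index set $\mathbb{N}=\{1,2,3,\dots\}$ is the set of infinite sequences $\boldsymbol{\omega}=\omega_1\omega_2\cdots$ of positive integers, with the metric $d(\boldsymbol{\alpha},\boldsymbol{\beta})=2^{-|\boldsymbol{\alpha}\wedge\boldsymbol{\beta}|}$, where $|\boldsymbol{\alpha}\wedge\boldsymbol{\beta}|$ is the length of the maximal common initial segment ($d=0$ if the sequences are equal). $\mathcal{F}$ is the Borel $\sigma$-algebra of $\Omega$; $\mathcal{B}(\mathbb{R})$ is the Borel $\sigma$-algebra of $\mathbb{R}$. For a finite nonempty $A\subset\mathbb{R}$, $\delta_A=\frac{1}{\#A}\sum_{a\in A}\delta_a$ with $\delta_a$ the Dirac measure at $a$; $cA=\{ca:a\in A\}$; $*$ is convolution of measures. Each $N_k$ is a real number $\ge2$. For a sequence $\mathbf{n}=\{n_k\}$ of positive integers and $\boldsymbol{\omega}\in\Omega$, put $$\mu^{\mathbf{n}}_{k}(\boldsymbol{\omega}) =\delta_{N_{\omega_{1}}^{-n_{1}}B_{\omega_{1}}} * \delta_{N_{\omega_{1}}^{-n_{1}}N_{\omega_{2}}^{-n_{2}}B_{\omega_{2}}} * \cdots * \delta_{N_{\omega_{1}}^{-n_{1}}\cdots N_{\omega_{k}}^{-n_{k}}B_{\omega_{k}}}.$$ The infinite convolution $\mu^{\mathbf{n}}(\boldsymbol{\omega})$ is said to exist if $\mu^{\mathbf{n}}_k(\boldsymbol{\omega})$ converges weakly, as $k\to\infty$, to a Borel probability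 measure on $\mathbb{R}$, and $\mu^{\mathbf{n}}(\boldsymbol{\omega})$ denotes this limit. When $n_k=1$ for all $k$, write $\mu(\boldsymbol{\omega})=\mu^{\mathbf{n}}(\boldsymbol{\omega})$. If $\mu(\boldsymbol{\omega})$ exists then $\mu^{\mathbf{n}}(\boldsymbol{\omega})$ exists for every $\mathbf{n}$, so under the hypotheses the mapping $\mu^{\mathbf{n}}$ is well defined. A set $\Psi$ of Borel probability measures on $\mathbb{R}$ is tight if for each $\epsilon>0$ there is a compact $K\subseteq\mathbb{R}$ with $\inf_{\nu\in\Psi}\nu(K)>1-\epsilon$. A mapping $M:\Omega\times\mathcal{E}\to[0,+\infty]$ is a random measure on a measurable space $(E,\mathcal{E})$ with respect to $(\Omega,\mathcal{F})$ if (i) $\boldsymbol{\omega}\mapsto M(\boldsymbol{\omega},A)$ is $\mathcal{F}$-measurable for every $A\in\mathcal{E}$, and (ii) $A\mapsto M(\boldsymbol{\omega},A)$ is a measure on $(E,\mathcal{E})$ for every $\boldsymbol{\omega}\in\Omega$. *)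

(* Defs.v *)
From HB Require Import structures.
From mathcomp Require Import all_boot all_order all_algebra finmap.
From mathcomp Require Import all_classical all_reals all_analysis.
From mathcomp Require Import measurable_realfun.

Set Implicit Arguments.
Unset Strict Implicit.
Unset Printing Implicit Defensive.

Import Order.TTheory GRing.Theory Num.Theory.
Import numFieldNormedType.Exports.

Local Open Scope classical_set_scope.
Local Open Scope ring_scope.

(* Infinite words over the alphabet of positive integers. Letters, positions and
   all sequences indexed by the positive integers are numbered from 0: the letter
   j : nat stands for the positive integer j.+1, and w i is the (i+1)-st letter.
   The argument R is a phantom: it only fixes the real numbers in which the
   metric takes its values. *)
Definition Omega (R : realType) : Type := nat -> nat.

HB.instance Definition _ (R : realType) := Choice.copy (Omega R) (nat -> nat).
HB.instance Definition _ (R : realType) := isPointed.Build (Omega R) (fun=> 0%N).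

Section omega_metric.
Context {R : realType}.
Implicit Types a b c : Omega R.

(* For a <> b, the first position (from 0) at which a and b differ is the
   length of their maximal common initial segment. *)
Definition word_dist a b : R :=
  if pselect (exists i, a i != b i) is left ab then 2 ^- ex_minn ab else 0.

Let word_dist_cases a b :
  (a = b /\ word_dist a b = 0) \/
  (exists m, [/\ a m != b m, forall i, (i < m)%N -> a i = b i
                & word_dist a b = 2 ^- m]).
Proof.
rewrite /word_dist; case: pselect => [ab|ab].
  right; case: ex_minnP => m abm mmin; exists m; split => // i im.
  by apply/eqP/negPn/negP => /mmin; rewrite leqNgt im.
left; split=> //; apply/funext => i; apply/eqP/negPn/negP => abi.
by apply: ab; exists i.
Qed.

Let word_dist_le a b n :
  (forall i, (i < n)%N -> a i = b i) -> word_dist a b <= 2 ^- n.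
Proof.
move=> abn; have [[_ ->]|[m [abm _ ->]]] := word_dist_cases a b.
  by rewrite invr_ge0 exprn_ge0.
rewrite lef_pV2 ?posrE ?exprn_gt0// ler_weXn2l ?ler1n//.
by rewrite leqNgt; apply/negP => /abn /eqP; rewrite (negbTE abm).
Qed.

Let word_distxx a : word_dist a a = 0.
Proof. by have [[]//|[m []]] := word_dist_cases a a; rewrite eqxx. Qed.

Let word_dist_positivity a b : word_dist a b = 0 -> a = b.
Proof.
have [[]//|[m [_ _ ->]]] := word_dist_cases a b.
by move/eqP; rewrite invr_eq0 expf_eq0 pnatr_eq0 andbF.
Qed.

Let word_dist_ge0 a b : 0 <= word_dist a b.
Proof.
have [[_ ->]//|[m [_ _ ->]]] := word_dist_cases a b.
by rewrite invr_ge0 exprn_ge0.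
Qed.

Let word_dist_sym_le a b : word_dist a b <= word_dist b a.
Proof.
have [[-> _]//|[m [_ bam ->]]] := word_dist_cases b a.
by apply: word_dist_le => i /bam.
Qed.

Let word_dist_sym a b : word_dist a b = word_dist b a.
Proof. by apply/eqP; rewrite eq_le !word_dist_sym_le. Qed.

Let word_dist_triangle b a c : word_dist a c <= word_dist a b + word_dist b c.
Proof.
have [[-> _]|[m [_ abm abE]]] := word_dist_cases a b.
  by rewrite lerDr.
have [[<- _]|[p [_ bcp bcE]]] := word_dist_cases b c.
  by rewrite lerDl.
have [mp|pm] := leqP m p.
- rewrite (@le_trans _ _ (word_dist a b)) ?lerDl// abE.
  by apply: word_dist_le => i im; rewrite abm// bcp// (leq_trans im).
- rewrite (@le_trans _ _ (word_dist b c)) ?lerDr// bcE.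
  by apply: word_dist_le => i ip; rewrite abm ?bcp// (ltn_trans ip).
Qed.

HB.instance Definition _ := @isMetric.Build R (Omega R) word_dist
  word_distxx word_dist_positivity word_dist_sym word_dist_triangle.

End omega_metric.

Definition borel (T : ptopologicalType) := g_sigma_algebraType (@open T).

Section measures_on_R.
Context {R : realType}.
Local Open Scope ereal_scope.

(* delta_A; the zero measure for A empty. *)
Definition unif_dirac (A : {fset R}) (S : set R) : \bar R :=
  (#|` A|%:R^-1)%:E * \sum_(a <- A) \d_a S.

Section unif_dirac_measure.
Variable A : {fset R}.

Let c : {nonneg R} := NngNum (eqbRL (@invr_ge0 R _) (ler0n R #|` A|)).

Let unif_diracE :
  unif_dirac A = mscale c (msum (fun i => \d_(nth 0%R A i)) #|` A|).
Proof.
apply/funext => S; rewrite /unif_dirac /mscale /msum /=; congr (_ * _).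
by rewrite (big_nth 0%R) big_mkord.
Qed.

Let unif_dirac0 : unif_dirac A set0 = 0.
Proof. by rewrite unif_diracE measure0. Qed.

Let unif_dirac_ge0 S : 0 <= unif_dirac A S.
Proof. by rewrite unif_diracE measure_ge0. Qed.

Let unif_dirac_sigma_additive : semi_sigma_additive (unif_dirac A).
Proof. by rewrite unif_diracE; exact: measure_semi_sigma_additive. Qed.

HB.instance Definition _ := isMeasure.Build _ _ _ (unif_dirac A)
  unif_dirac0 unif_dirac_ge0 unif_dirac_sigma_additive.

Let unif_dirac_fin : fin_num_fun (unif_dirac A).
Proof.
move=> S mS; rewrite /unif_dirac fin_numM// sum_fin_num.
by apply/allP => _ /mapP[a _ ->]; exact: fin_num_measure.
Qed.

HB.instance Definition _ :=
  @Measure_isFinite.Build _ _ _ (unif_dirac A) unif_dirac_fin.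

End unif_dirac_measure.

Definition mconv (mu nu : {finite_measure set R -> \bar R}) : set R -> \bar R :=
  pushforward (mu \x nu) (fun p : R * R => (p.1 + p.2)%R).

Section mconv_measure.
Variables mu nu : {finite_measure set R -> \bar R}.

Let measurable_add :
  measurable_fun [set: R * R] (fun p : R * R => (p.1 + p.2)%R).
Proof. exact: measurable_funD. Qed.

Let mconv0 : mconv mu nu set0 = 0.
Proof. by rewrite /mconv /pushforward preimage_set0 measure0. Qed.

Let mconv_ge0 S : 0 <= mconv mu nu S.
Proof. exact: measure_ge0. Qed.

Let mconv_sigma_additive : semi_sigma_additive (mconv mu nu).
Proof.
move=> F mF tF mUF.
have ms S : measurable S ->
    measurable ((fun p : R * R => (p.1 + p.2)%R) @^-1` S).
  by move=> mS; rewrite -[X in measurable X]setTI; exact: measurable_add.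
rewrite /mconv /pushforward preimage_bigcup.
apply: measure_semi_sigma_additive.
- by move=> i; apply: ms; exact: mF.
- apply/trivIsetP => /= i j _ _ ij; rewrite -preimage_setI.
  by move/trivIsetP : tF => /(_ _ _ _ _ ij) ->//; rewrite preimage_set0.
- by rewrite -preimage_bigcup; exact: ms.
Qed.

HB.instance Definition _ := isMeasure.Build _ _ _ (mconv mu nu)
  mconv0 mconv_ge0 mconv_sigma_additive.

Let mconv_fin : fin_num_fun (mconv mu nu).
Proof.
apply: lty_fin_num_fun.
rewrite /= /mconv /pushforward preimage_setT -setXTT product_measure1E//.
by rewrite ltey_eq fin_numM//; exact: fin_num_measure.
Qed.

HB.instance Definition _ :=
  @Measure_isFinite.Build _ _ _ (mconv mu nu) mconv_fin.

End mconv_measure.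

Definition weak_cvg (mu : nat -> {finite_measure set R -> \bar R})
    (nu : probability R R) : Prop :=
  forall f : R -> R, continuous f -> (exists C : R, forall x, (`|f x| <= C)%R) ->
    \int[mu k]_x (f x)%:E @[k --> \oo] --> \int[nu]_x (f x)%:E.

Definition tight (Psi : set (probability R R)) : Prop :=
  forall eps : R, (0 < eps)%R -> exists K : set R,
    compact K /\ (1 - eps)%:E < ereal_inf [set nu K | nu in Psi].

End measures_on_R.

Section infinite_convolution.
Context {R : realType}.
Variables (N : nat -> R) (B : nat -> {fset R}) (n : nat -> nat) (w : Omega R).

(* The k-th factor, k from 0: delta of N_(w 0)^-(n 0) ... N_(w k)^-(n k) B_(w k). *)
Definition conv_factor (k : nat) : {finite_measure set R -> \bar R} :=
  unif_dirac [fset (\prod_(i < k.+1) N (w i) ^- n i) * b | b in B (w k)]%fset.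

(* The convolution of the factors 0, ..., k. *)
Fixpoint partial_conv (k : nat) : {finite_measure set R -> \bar R} :=
  if k is k'.+1 then mconv (partial_conv k') (conv_factor k)
  else conv_factor 0.

Definition infconv_exists : Prop :=
  exists nu : probability R R, weak_cvg partial_conv nu.

(* A default value when infconv_exists does not hold. *)
Definition infconv : probability R R :=
  get [set nu : probability R R | weak_cvg partial_conv nu].

End infinite_convolution.

Definition random_measure d d' (W : measurableType d) (E : measurableType d')
    (R : realType) (M : W -> set E -> \bar R) : Prop :=
  (forall A : set E, measurable A -> measurable_fun [set: W] (fun w => M w A)) /\
  (* The library's measures are functions on all subsets of E of which only the
     values on measurable sets matter. *)
  (forall w : W, exists m : {measure set E -> \bar R},
     forall A : set E, measurable A -> M w A = m A).

(* Main.v *)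
Require Import Defs.
From HB Require Import structures.
From mathcomp Require Import all_boot all_order all_algebra finmap.
From mathcomp Require Import all_classical all_reals all_analysis.
From mathcomp Require Import measurable_realfun.

Set Implicit Arguments.
Unset Strict Implicit.
Unset Printing Implicit Defensive.

Import Order.TTheory GRing.Theory Num.Theory.
Import numFieldNormedType.Exports.

Local Open Scope classical_set_scope.
Local Open Scope ring_scope.

(** Two things have to be proved: that the infinite convolution exists for
    every sequence of positive exponents, and that its value on a fixed Borel set is a
    measurable function of the word.

    Existence. The partial convolution of order k is the law of a sum of k + 1
    independent random variables, uniform on the sets N_(w 0)^-(n 0) ...
    N_(w i)^-(n i) B_(w i), which are nonnegative because the B_j are. Hence
    its distribution function decreases as k grows ([partial_conv_ray_anti]).
    Raising the exponents from 1 to n shrinks every summand, so it increases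
    the distribution function ([partial_conv_ray_le]). Since the partial
    convolutions with exponents 1 converge weakly to a probability measure, no
    mass escapes to infinity along them ([weak_cvg_ray_tight]), and by the
    comparison none escapes for the exponents n either. It remains to see that
    a stochastically increasing sequence of probability measures without escape
    of mass converges weakly ([weak_cvg_monotone]). To this end all the measures
    are realised on one probability space, ]0, 1[ with the Lebesgue measure, as
    the laws of their quantile functions ([distribution_quantile]). The quantile
    functions increase with k and stay bounded at each point, so they converge
    pointwise; by dominated convergence their laws converge weakly to the law of
    the limit.

    Measurability. By a Dynkin class argument the rays ]-oo, x] suffice
    ([measurable_probability_rays]). The measure of a ray is the limit of the
    integrals of continuous cutoff functions ([cvg_integral_cutoff]), and each
    of these is the limit, by weak convergence, of the integrals against the
    partial convolutions. The latter depend on finitely many letters only, so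
    they are locally constant in the word ([measurable_prefix_dependent]).
    Thus the measure of a ray is an iterated pointwise limit of measurable
    functions of the word ([measurable_infconv]). *)

(** * Rays and distribution functions *)

Section cdf_limits.
Context {R : realType}.
Local Open Scope ereal_scope.
Variable P : probability R R.

Let X : {mfun R >-> R} :=
  HB.pack (idfun : R -> R)
    (@isMeasurableFun.Build _ _ R R idfun (@measurable_id _ R setT)).

Let cdfE : cdf (X : {RV P >-> R}) = fun x : R => P `]-oo, x]%classic.
Proof.
by apply/funext => x; rewrite /cdf /distribution /pushforward preimage_id.
Qed.

(** The three lemmas of this section are the limits at both ends and the
    right continuity of a distribution function, in the form in which the
    infimum defining a quantile uses them. *)
Lemma probability_ray_lt (e : R) : (0 < e)%R ->
  exists x, P `]-oo, x]%classic < e%:E.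
Proof.
move=> e0; have := @cvg_cdfNy0 _ _ _ P X; rewrite cdfE.
move=> cvgP; have /(@filter_ex _ (-oo%R : set_system R)) :=
  cvgP _ (@nbhs_open_ereal_lt _ 0%R (cst e) e0).
by case=> x Px; exists x.
Qed.

Lemma probability_ray_gt (e : R) : (e < 1)%R ->
  exists x, e%:E < P `]-oo, x]%classic.
Proof.
move=> e1; have := @cvg_cdfy1 _ _ _ P X; rewrite cdfE.
move=> cvgP; have /(@filter_ex _ (+oo%R : set_system R)) :=
  cvgP _ (@nbhs_open_ereal_gt _ 1%R (cst e) e1).
by case=> x Px; exists x.
Qed.

Lemma probability_ray_right (u x : R) :
  (forall y, (x < y)%R -> u%:E <= P `]-oo, y]%classic) ->
  u%:E <= P `]-oo, x]%classic.
Proof.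
move=> uP; rewrite leNgt; apply/negP => Pxu.
have := @cdf_right_continuous _ _ _ P X x; rewrite cdfE.
rewrite /= -(@fineK _ (P `]-oo, x]%classic)) ?fin_num_measure//.
have {}Pxu : (fine (P `]-oo, x]%classic) < u)%R.
  by rewrite -lte_fin fineK// fin_num_measure.
move=> /(_ _ (@nbhs_open_ereal_lt _ _ (cst u) Pxu)) Pu.
have [y [/= Py xy]] :=
  @filter_ex _ (x^'+ : set_system R) _ _
    (@filterI _ (x^'+ : set_system R) _ _ _ Pu (nbhs_right_gt x)).
by have := uP _ xy; rewrite leNgt Py.
Qed.

End cdf_limits.

Section rays.
Context {R : realType}.
Local Open Scope ereal_scope.

Definition rays : set (set R) := [set A | exists x : R, A = `]-oo, x]%classic].

Lemma measurable_raysE : @measurable _ R = <<s rays >>.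
Proof.
rewrite [LHS](RGenOInfty.measurableE R); apply/seteqP; split.
  apply: smallest_sub; first exact: smallest_sigma_algebra.
  move=> _ [x ->]; rewrite -setCitvl -setTD.
  have [_ sC _] := smallest_sigma_algebra setT rays.
  by apply: sC; apply: sub_sigma_algebra; exists x.
apply: smallest_sub; first exact: smallest_sigma_algebra.
move=> _ [x ->]; rewrite -setCitvr -setTD.
have [_ sC _] := smallest_sigma_algebra setT (@RGenOInfty.G R).
by apply: sC; apply: sub_sigma_algebra; exists x.
Qed.

Lemma setI_closed_rays : setI_closed rays.
Proof.
move=> _ _ [x ->] [y ->]; exists (Num.min x y).
by apply/seteqP; split=> z; rewrite /= !in_itv/= le_min => /andP.
Qed.

Lemma measure_eq_rays (mu nu : {finite_measure set R -> \bar R}) :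
  (forall x : R, mu `]-oo, x]%classic = nu `]-oo, x]%classic) ->
  forall A, measurable A -> mu A = nu A.
Proof.
move=> munu.
apply: (measure_unique rays (fun k : nat => `]-oo, k%:R]%classic)).
- exact: measurable_raysE.
- exact: setI_closed_rays.
- by move=> k; exists k%:R.
- apply/seteqP; split=> // x _; exists (Num.truncn x).+1 => //=.
  by rewrite in_itv/= ltW// Num.Theory.truncnS_gt.
- by move=> _ [x ->]; exact: munu.
- by move=> k; rewrite ltey_eq; apply/orP; left; exact: fin_num_measure.
Qed.

Lemma bounded_integrable d (T : measurableType d)
    (mu : {finite_measure set T -> \bar R}) (f : T -> R) :
  measurable_fun setT f -> (exists C : R, forall x, (`|f x| <= C)%R) ->
  mu.-integrable setT (EFin \o f).
Proof.
move=> mf [C fC]; apply: (@le_integrable _ _ _ mu _ measurableT _ (cst C%:E)).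
- exact: measurableT_comp.
- by move=> x _ /=; rewrite lee_fin (le_trans (fC x))// ler_norm.
- exact: finite_measure_integrable_cst.
Qed.

End rays.

(** * Quantile functions *)

Section quantile.
Context {R : realType}.
Local Open Scope ereal_scope.
Local Notation leb := (@lebesgue_measure R).

Definition quantile (P : set R -> \bar R) (u : R) : R :=
  inf [set x | u%:E <= P `]-oo, x]%classic].

(** This Galois connection between quantile and distribution function is what
    makes the quantile a random variable with law P. The right continuity of
    the distribution function is needed from left to right. *)
Lemma quantile_le (P : probability R R) (u x : R) : (0 < u < 1)%R ->
  (quantile P u <= x)%R = (u%:E <= P `]-oo, x]%classic).
Proof.
move=> /andP[u0 u1]; have [a Pa] := probability_ray_lt P u0.
have [b Pb] := probability_ray_gt P u1.
have Pmono y z : (y <= z)%R -> P `]-oo, y]%classic <= P `]-oo, z]%classic.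
  by move=> yz; rewrite le_measure ?inE//; exact: subset_itvl.
have lba : lbound [set y | u%:E <= P `]-oo, y]%classic] a.
  move=> y /= uPy; rewrite leNgt; apply/negP => /ltW/Pmono Pya.
  by have := le_lt_trans (le_trans uPy Pya) Pa; rewrite ltxx.
have hinf : has_inf [set y | u%:E <= P `]-oo, y]%classic].
  by split; [exists b; exact: ltW|exists a].
apply/idP/idP => [qx|uPx].
  apply: probability_ray_right => y xy.
  have [z uPz zy] := inf_lt hinf.1 (le_lt_trans qx xy).
  by rewrite (le_trans uPz)// Pmono// ltW.
by apply: ge_inf => //; exists a.
Qed.

(** Outside ]0, 1[ the infimum defining a quantile may be that of an empty or
    unbounded set; there the function is set to 0. *)
Definition unit_quantile (P : probability R R) : measurableTypeR R -> R :=
  quantile P \_ `]0%R, 1%R[.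

Lemma unit_quantileE P u : (0 < u < 1)%R -> unit_quantile P u = quantile P u.
Proof. by move=> u01; rewrite /unit_quantile patchE mem_set//= in_itv. Qed.

Lemma quantile_preimage (P : probability R R) x :
  `]0%R, 1%R[ `&` quantile P @^-1` `]-oo, x] =
  `]0%R, 1%R[ `&` `]-oo, fine (P `]-oo, x]%classic)].
Proof.
apply/seteqP; split => u /=; rewrite !in_itv /= => -[u01];
  by rewrite quantile_le// -lee_fin fineK// fin_num_measure.
Qed.

Lemma measurable_unit_quantile (P : probability R R) :
  measurable_fun setT (unit_quantile P).
Proof.
apply: (measurable_restrictT (quantile P) (measurable_itv `]0%R, 1%R[)).1 => mD.
apply: (measurability _ (RGenOInfty.measurableE R)) => //.
move=> _ [_ [x ->] <-].
(* The preimage of ]x, +oo[ is the complement in ]0, 1[ of that of ]-oo, x]. *)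
rewrite -setCitvl preimage_setC -setDE -[_ `\` _]set0U.
rewrite -(setDv `]0%R, 1%R[%classic) -setDIr quantile_preimage.
by apply: measurableD => //; exact: measurableI.
Qed.

HB.instance Definition _ (P : probability R R) :=
  isMeasurableFun.Build _ _ _ _ (unit_quantile P) (measurable_unit_quantile P).

(** [lebesgue_measure] has domain [measurableTypeR R], whose display differs
    from that of [R]; hence the explicit domain. *)
Definition unit_uniform : set (measurableTypeR R) -> \bar R :=
  mrestr leb (measurable_itv `]0%R, 1%R[).

HB.instance Definition _ := Measure.on unit_uniform.

Lemma unit_uniform_quantile (P : probability R R) x :
  unit_uniform (unit_quantile P @^-1` `]-oo, x]) = P `]-oo, x]%classic.
Proof.
rewrite /unit_uniform /mrestr setIC.
have -> : `]0%R, 1%R[ `&` unit_quantile P @^-1` `]-oo, x] =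
    `]0%R, 1%R[ `&` quantile P @^-1` `]-oo, x].
  apply/seteqP; split => u /= [u01]; rewrite in_itv/= in u01;
  by rewrite unit_quantileE// in_itv.
rewrite quantile_preimage.
have FP : (fine (P `]-oo, x]%classic))%:E = P `]-oo, x]%classic.
  by rewrite fineK// fin_num_measure.
have F0 : (0 <= fine (P `]-oo, x]%classic))%R by rewrite fine_ge0.
have F1 : (fine (P `]-oo, x]%classic) <= 1)%R.
  by rewrite -lee_fin FP probability_le1.
rewrite -[RHS]FP; set F := fine _ in F0 F1 *.
have [F1'|F1'] := ltP F 1%R.
  rewrite (_ : _ `&` _ = `]0%R, F]%classic); last first.
    apply/seteqP; split => u /=; rewrite !in_itv/=.
      by move=> [/andP[-> _] ->].
    by move=> /andP[-> uF]; rewrite uF (le_lt_trans uF).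
  rewrite lebesgue_measure_itv/= lte_fin; case: ltP; rewrite ?oppr0 ?adde0//.
  by move=> F0'; congr EFin; apply/eqP; rewrite eq_le F0.
have -> : F = 1%R by apply/eqP; rewrite eq_le F1.
rewrite (_ : _ `&` _ = `]0%R, 1%R[%classic); last first.
  apply/seteqP; split => u /=; rewrite !in_itv/=; first by case.
  by move=> /andP[-> u1]; rewrite u1 ltW.
by rewrite lebesgue_measure_itv/= lte_fin ltr01 oppr0 adde0.
Qed.

Lemma unit_uniform_setT : unit_uniform setT = 1.
Proof.
rewrite /unit_uniform /mrestr setTI.
by rewrite lebesgue_measure_itv/= lte_fin ltr01 oppr0 adde0.
Qed.

HB.instance Definition _ :=
  Measure_isProbability.Build _ _ _ unit_uniform unit_uniform_setT.

(** Inverse transform sampling: every probability measure on the line is a law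
    on the one space ]0, 1[. *)
Lemma distribution_quantile (P : probability R R) A : measurable A ->
  distribution unit_uniform (unit_quantile P) A = P A.
Proof.
by apply: measure_eq_rays => x; exact: unit_uniform_quantile.
Qed.

Lemma integral_bounded_distribution
    (X : {RV unit_uniform >-> R}) (f : R -> R) :
  measurable_fun setT f -> (exists C : R, forall x, (`|f x| <= C)%R) ->
  \int[distribution unit_uniform X]_x (f x)%:E =
  \int[unit_uniform]_u (f (X u))%:E.
Proof.
move=> mf [C fC]; rewrite integral_distribution//.
  exact: measurableT_comp.
apply: bounded_integrable; last by exists C.
exact: measurableT_comp.
Qed.

Lemma integral_quantile (P : probability R R) (f : R -> R) :
  measurable_fun setT f -> (exists C : R, forall x, (`|f x| <= C)%R) ->
  \int[P]_x (f x)%:E = \int[unit_uniform]_u (f (unit_quantile P u))%:E.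
Proof.
move=> mf bf; rewrite -integral_bounded_distribution//.
apply: eq_measure_integral => A mA _; exact/esym/distribution_quantile.
Qed.

End quantile.

(** * Weak limits of stochastically increasing sequences *)

Section monotone_weak_limit.
Context {R : realType}.
Local Open Scope ereal_scope.

(** A stochastically larger measure has larger quantiles; this turns the
    stochastic order into the pointwise order. *)
Lemma quantile_anti (P P' : probability R R) (u : R) : (0 < u < 1)%R ->
  (forall x : R, P' `]-oo, x]%classic <= P `]-oo, x]%classic) ->
  (quantile P u <= quantile P' u)%R.
Proof.
move=> u01 PP'; rewrite quantile_le// (le_trans _ (PP' _))//.
by rewrite -quantile_le.
Qed.

(** The quantile functions increase with k, and the last hypothesis bounds them
    at each point of ]0, 1[. Their pointwise supremum is therefore their limit,
    and its law is the weak limit. *)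
Lemma weak_cvg_monotone (mu : nat -> {finite_measure set R -> \bar R}) :
  (forall k, mu k setT = 1) ->
  (forall k (x : R), mu k.+1 `]-oo, x]%classic <= mu k `]-oo, x]%classic) ->
  (forall e : R, (e < 1)%R ->
    exists x : R, forall k, e%:E < mu k `]-oo, x]%classic) ->
  exists nu : probability R R, weak_cvg mu nu.
Proof.
move=> mu1 mu_anti mu_tight.
pose P k : probability R R :=
    HB.pack_for (probability R R) (Measure.sort (mu k))
      (Measure_isProbability.Build _ _ _ (mu k) (mu1 k)).
pose q k := unit_quantile (P k).
pose Q u : R := sup (range (q ^~ u)).
have q_cvg u : q ^~ u @ \oo --> Q u.
  have [u01|u01] := boolP (0 < u < 1)%R; last first.
    have q0 k : q k u = 0%R.
      by rewrite /q /unit_quantile patchE memNset//= in_itv/=; exact/negP.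
    rewrite /Q (_ : q ^~ u = cst 0%R); last by apply/funext.
    rewrite (_ : range _ = [set 0%R]) ?sup1; first exact: cvg_cst.
    by apply/seteqP; split=> [_ [_ _ <-]//|_ ->]; exists 0%N.
  apply: nondecreasing_cvgn.
    apply/nondecreasing_seqP => k.
    by rewrite /q !unit_quantileE//; apply: quantile_anti => //; exact: mu_anti.
  have [x mux] := mu_tight u (andP u01).2.
  exists x => _ [k _ <-]; rewrite /q unit_quantileE// quantile_le//.
  exact/ltW/mux.
have mQ : measurable_fun setT Q.
  apply: (measurable_fun_cvg (h := q)) => // k; exact: measurable_funP.
pose X : {mfun measurableTypeR R >-> R} :=
  HB.pack Q (isMeasurableFun.Build _ _ _ _ Q mQ).
exists (distribution unit_uniform X) => f cf bf.
have mf : measurable_fun setT f by exact: continuous_measurable_fun.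
rewrite integral_bounded_distribution//.
have -> : (fun k => \int[mu k]_x (f x)%:E) =
    (fun k => \int[unit_uniform]_u (f (q k u))%:E).
  by apply/funext => k; rewrite -integral_quantile.
have [C fC] := bf.
apply: (@dominated_cvg _ _ _ _ _ measurableT _ _ (cst C%:E)) => //.
- by move=> k; do 2 apply: measurableT_comp => //.
- move=> u _; apply: (cvg_comp _ _ (cvg_comp _ _ (q_cvg u) (cf (Q u)))).
  by [].
- exact: finite_measure_integrable_cst.
- by move=> k u _; rewrite lee_fin.
Qed.

End monotone_weak_limit.

(** * Distribution functions of the partial convolutions *)

Section convolution_with_uniform.
Context {R : realType}.
Local Open Scope ereal_scope.

Lemma mconv_unif_dirac (mu : {finite_measure set R -> \bar R}) (A : {fset R})
    (S : set R) : measurable S ->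
  mconv mu (unif_dirac A) S =
  (#|` A|%:R^-1)%:E * \sum_(a <- A) mu ((fun x : R => (x + a)%R) @^-1` S).
Proof.
move=> mS; rewrite /mconv /pushforward /= /product_measure1 /unif_dirac.
have mSa a : measurable ((fun x : R => (x + a)%R) @^-1` S).
  by rewrite -[X in measurable X]setTI; exact: measurable_funD.
transitivity (\int[mu]_x ((#|` A|%:R^-1)%:E *
    \sum_(a <- A) (\1_((fun x : R => (x + a)%R) @^-1` S) x)%:E)).
  apply: eq_integral => x _ /=; congr (_ * _); apply: eq_bigr => a _.
  rewrite diracE indicE; congr (_%:R%:E); congr nat_of_bool.
  by apply/idP/idP; rewrite !inE /xsection/= ?inE.
have mind a : measurable_fun setT
    (EFin \o \1_((fun x : R => (x + a)%R) @^-1` S) : R -> \bar R).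
  by apply/measurable_EFinP; exact: measurable_indic.
rewrite ge0_integralZl//=.
- congr (_ * _); rewrite ge0_integral_sum//=.
  + by apply: eq_bigr => a _; rewrite integral_indic// setIT.
- by apply: emeasurable_sum => a; exact: mind.
- by move=> x _; rewrite sume_ge0.
Qed.

Lemma imfset_scale_size (c : R) (A : {fset R}) : c != 0%R ->
  #|` [fset (c * b)%R | b in A]%fset| = #|` A|.
Proof. by move=> c0; rewrite card_imfset//; exact: mulfI. Qed.

(** Convolving with the uniform law on c A averages the shifts of the
    distribution function by the points of c A. The average is written over A
    itself, so that the results for two different c can be compared term by
    term. *)
Lemma mconv_scale (mu : {finite_measure set R -> \bar R}) (c : R) (A : {fset R})
    (x : R) : c != 0%R ->
  mconv mu (unif_dirac [fset (c * b)%R | b in A]%fset) `]-oo, x]%classic =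
  (#|` A|%:R^-1)%:E * \sum_(b <- A) mu `]-oo, (x - c * b)%R]%classic.
Proof.
move=> c0; rewrite mconv_unif_dirac// imfset_scale_size//; congr (_ * _).
rewrite big_imfset/=; last by move=> ? ? _ _; exact: mulfI.
apply: eq_bigr => b _; congr (mu _); apply/seteqP.
by split => y /=; rewrite !in_itv/= lerBrDr.
Qed.

(** The case of [mconv_scale] where the first factor is the unit mass at 0,
    which is how the first partial convolution fits the same pattern. *)
Lemma unif_dirac_scale (c : R) (A : {fset R}) (x : R) : c != 0%R ->
  unif_dirac [fset (c * b)%R | b in A]%fset `]-oo, x]%classic =
  (#|` A|%:R^-1)%:E *
  \sum_(b <- A) (\d_(0%R : R) `]-oo, (x - c * b)%R]%classic).
Proof.
move=> c0; rewrite /unif_dirac imfset_scale_size//; congr (_ * _).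
rewrite big_imfset/=; last by move=> ? ? _ _; exact: mulfI.
apply: eq_bigr => b _; rewrite !diracE; congr (_%:R%:E); congr nat_of_bool.
by apply/idP/idP; rewrite !inE/= !in_itv/= subr_ge0.
Qed.

Lemma mean_cst (A : {fset R}) (r : \bar R) : A <> fset0 ->
  (#|` A|%:R^-1)%:E * \sum_(b <- A) r = r.
Proof.
move=> A0; have A_neq0 : (#|` A|%:R != 0 :> R)%R.
  by rewrite pnatr_eq0 cardfs_eq0; apply/eqP.
rewrite big_const_seq count_predT.
have -> m : iter m (+%E r) 0 = r *+ m by
    by elim: m => // m IH; rewrite iterS IH muleS.
by rewrite -mule_natl muleA -EFinM mulVf// mul1e.
Qed.

Lemma le_mean (A : {fset R}) (f g : R -> \bar R) :
  (forall b, b \in A -> f b <= g b) ->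
  (#|` A|%:R^-1)%:E * \sum_(b <- A) f b <=
  (#|` A|%:R^-1)%:E * \sum_(b <- A) g b.
Proof.
move=> fg; rewrite lee_wpmul2l// big_seq [leRHS]big_seq.
exact: lee_sum.
Qed.

End convolution_with_uniform.

Section partial_convolutions.
Context {R : realType}.
Variables (N : nat -> R) (B : nat -> {fset R}).
Hypothesis hN : forall k, 2 <= N k.
Hypothesis hB : forall k, B k <> fset0.
Hypothesis hB0 : forall k b, b \in B k -> 0 <= b.
Local Open Scope ereal_scope.

Let N_gt0 k : (0 < N k)%R. Proof. exact: lt_le_trans (hN k). Qed.

Definition scale (n : nat -> nat) (w : Omega R) (k : nat) : R :=
  (\prod_(i < k.+1) N (w i) ^- n i)%R.

Let scale_gt0 n w k : (0 < scale n w k)%R.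
Proof. by apply: prodr_gt0 => i _; rewrite invr_gt0 exprn_gt0. Qed.

Let scale_neq0 n w k : scale n w k != 0%R.
Proof. exact/lt0r_neq0/scale_gt0. Qed.

Lemma le_scale n w k : (forall i, (0 < n i)%N) ->
  (scale n w k <= scale (fun=> 1%N) w k)%R.
Proof.
move=> n0; apply: ler_prod => i _.
rewrite invr_ge0 exprn_ge0 ?(ltW (N_gt0 _))//=.
rewrite lef_pV2 ?posrE ?exprn_gt0// ler_weXn2l//.
by rewrite (le_trans _ (hN _))// ler1n.
Qed.

Let scaled_neq0 n w k : [fset (scale n w k * b)%R | b in B (w k)]%fset <> fset0.
Proof.
apply/eqP; rewrite -cardfs_eq0 imfset_scale_size// cardfs_eq0.
exact/eqP/hB.
Qed.

Lemma partial_conv_setT n w k : partial_conv N B n w k setT = 1.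
Proof.
elim: k => [|k IH] /=.
  rewrite /unif_dirac (eq_bigr (fun=> 1)); last by move=> a _; rewrite diracT.
  exact/mean_cst/scaled_neq0.
rewrite mconv_unif_dirac// (eq_bigr (fun=> 1)); last first.
  by move=> a _; rewrite preimage_setT IH.
exact/mean_cst/scaled_neq0.
Qed.

Lemma partial_conv0_ray n w x :
  partial_conv N B n w 0%N `]-oo, x]%classic =
  (#|` B (w 0%N)|%:R^-1)%:E *
  \sum_(b <- B (w 0%N)) \d_(0%R : R) `]-oo, (x - scale n w 0%N * b)%R]%classic.
Proof. exact: (unif_dirac_scale _ _ (scale_neq0 n w 0%N)). Qed.

Lemma partial_convS_ray n w k x :
  partial_conv N B n w k.+1 `]-oo, x]%classic =
  (#|` B (w k.+1)|%:R^-1)%:E *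
  \sum_(b <- B (w k.+1))
    partial_conv N B n w k `]-oo, (x - scale n w k.+1 * b)%R]%classic.
Proof. exact: (mconv_scale _ _ _ (scale_neq0 n w k.+1)). Qed.

Let le_ray (mu : {measure set R -> \bar R}) (x y : R) : (x <= y)%R ->
  mu `]-oo, x]%classic <= mu `]-oo, y]%classic.
Proof. by move=> xy; rewrite le_measure ?inE//; exact: subset_itvl. Qed.

(** The next summand is nonnegative, so adding it moves mass to the right. *)
Lemma partial_conv_ray_anti n w k x :
  partial_conv N B n w k.+1 `]-oo, x]%classic <=
  partial_conv N B n w k `]-oo, x]%classic.
Proof.
rewrite partial_convS_ray -[leRHS](mean_cst _ (@hB (w k.+1))).
apply: le_mean => b /hB0 b0; apply: le_ray.
by rewrite gerBl mulr_ge0// ltW.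
Qed.

(** Larger exponents give smaller scales, hence smaller shifts to the right. *)
Lemma partial_conv_ray_le n w k x : (forall i, (0 < n i)%N) ->
  partial_conv N B (fun=> 1%N) w k `]-oo, x]%classic <=
  partial_conv N B n w k `]-oo, x]%classic.
Proof.
move=> n0; elim: k x => [|k IH] x.
  rewrite !partial_conv0_ray; apply: le_mean => b /hB0 b0; apply: le_ray.
  by rewrite lerD2l lerN2 ler_wpM2r// le_scale.
rewrite !partial_convS_ray; apply: le_mean => b /hB0 b0.
apply: le_trans (IH _); apply: le_ray.
by rewrite lerD2l lerN2 ler_wpM2r// le_scale.
Qed.

End partial_convolutions.

(** * Cutoff functions *)

Section cutoff.
Context {R : realType}.
Local Open Scope ereal_scope.

(** A continuous majorant of the indicator of ]-oo, x]; for m > 0 it decreases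
    from 1 to 0 with slope - m on the interval from x to x + 1 / m. *)
Definition cutoff (x : R) (m : nat) (t : R) : R :=
  (Num.max 0 (Num.min 1 (1 - m%:R * (t - x))))%R.

Lemma continuous_cutoff x m : continuous (cutoff x m).
Proof.
move=> t; pose g t : R := (1 - m%:R * (t - x))%R.
rewrite (_ : cutoff x m = (cst 0 \max (cst 1 \min g))%R)//.
apply: continuous_max; first exact: cvg_cst.
apply: continuous_min; first exact: cvg_cst.
apply: cvgB; first exact: cvg_cst.
by apply: cvgM; [exact: cvg_cst|apply: cvgB => //; exact: cvg_cst].
Qed.

Lemma measurable_cutoff x m : measurable_fun setT (EFin \o cutoff x m).
Proof.
apply/measurable_EFinP.
have c := @continuous_cutoff x m; exact: (continuous_measurable_fun c).
Qed.

Lemma cutoff_ge0 x m t : (0 <= cutoff x m t)%R.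
Proof. by rewrite /cutoff le_max lexx. Qed.

Lemma cutoff_le1 x m t : (cutoff x m t <= 1)%R.
Proof. by rewrite /cutoff ge_max ler01 ge_min lexx. Qed.

Lemma cutoff_bounded x m : exists C : R, forall t, (`|cutoff x m t| <= C)%R.
Proof. by exists 1%R => t; rewrite ger0_norm ?cutoff_ge0 ?cutoff_le1. Qed.

Lemma cutoff_eq1 x m t : (t <= x)%R -> cutoff x m t = 1%R.
Proof.
move=> tx; have h : (1 <= 1 - m%:R * (t - x))%R.
  by rewrite lerDl oppr_ge0 mulr_ge0_le0// subr_le0.
by rewrite /cutoff min_l// max_r.
Qed.

Lemma cutoff_eq0 x m t : (1 <= m%:R * (t - x))%R -> cutoff x m t = 0%R.
Proof.
move=> h; rewrite /cutoff max_l// ge_min; apply/orP; right.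
by rewrite subr_le0.
Qed.

Lemma cvg_cutoff x t :
  cutoff x ^~ t @ \oo --> (\1_(`]-oo, x]%classic) t : R).
Proof.
rewrite indicE; have [tx|xt] := leP t x.
  rewrite mem_set/= ?in_itv//.
  rewrite (_ : cutoff x ^~ t = cst 1%R); first exact: cvg_cst.
  by apply/funext => m; rewrite cutoff_eq1.
rewrite memNset/=; last by rewrite in_itv/= leNgt xt.
apply: cvg_near_cst; near=> m; apply/cutoff_eq0.
rewrite -ler_pdivrMr ?subr_gt0// div1r; near: m.
exact: nbhs_infty_ger.
Unshelve. all: by end_near. Qed.

Lemma cvg_integral_cutoff (mu : {finite_measure set R -> \bar R}) x :
  \int[mu]_t (cutoff x m t)%:E @[m --> \oo] --> mu `]-oo, x]%classic.
Proof.
rewrite -[X in _ --> mu X]setIT -integral_indic//.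
apply: (@dominated_cvg _ _ _ _ _ measurableT _ _ (cst 1%:E)) => //.
- by move=> m; exact: measurable_cutoff.
- move=> t _; apply: cvg_EFin; last exact: cvg_cutoff.
  exact: nearW.
- exact: finite_measure_integrable_cst.
- by move=> m t _; rewrite lee_fin ger0_norm ?cutoff_ge0 ?cutoff_le1.
Qed.

(** If nu gives mass more than e to ]-oo, x], then so do the measures mu k to
    ]-oo, x + 1] for large k, as the cutoff of slope 1 between the two rays
    shows. The monotonicity of the distribution functions in k carries this
    over to the first few k. *)
Lemma weak_cvg_ray_tight (mu : nat -> {finite_measure set R -> \bar R})
    (nu : probability R R) : weak_cvg mu nu ->
  (forall k (x : R), mu k.+1 `]-oo, x]%classic <= mu k `]-oo, x]%classic) ->
  forall e : R, (e < 1)%R ->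
  exists x : R, forall k, e%:E < mu k `]-oo, x]%classic.
Proof.
move=> munu mu_anti e e1; have [x nux] := probability_ray_gt nu e1.
have enu : e%:E < \int[nu]_t (cutoff x 1 t)%:E.
  apply: lt_le_trans nux _; rewrite -[X in nu X]setIT -integral_indic//.
  apply: ge0_le_integral => //.
  - by apply/measurable_EFinP; exact: measurable_indic.
  - exact: measurable_cutoff.
  - move=> t _; rewrite lee_fin indicE.
    have [|_] := boolP (t \in _); last exact: cutoff_ge0.
    by rewrite inE/= in_itv/= => tx; rewrite cutoff_eq1.
have int_le k : \int[mu k]_t (cutoff x 1 t)%:E <=
    mu k `]-oo, (x + 1)%R]%classic.
  rewrite -[X in mu k X]setIT -integral_indic//.
  apply: ge0_le_integral => //.
  - by move=> t _; rewrite lee_fin cutoff_ge0.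
  - exact: measurable_cutoff.
  - by apply/measurable_EFinP; exact: measurable_indic.
  - move=> t _; rewrite lee_fin indicE.
    have [_|] := boolP (t \in _); first exact: cutoff_le1.
    rewrite notin_setE/= in_itv/= => /negP; rewrite -ltNge => xt.
    by rewrite cutoff_eq0// mul1r lerBrDl ltW.
exists (x + 1)%R => k.
have := munu _ (@continuous_cutoff x 1) (cutoff_bounded x 1).
have nu_fin : \int[nu]_t (cutoff x 1 t)%:E \is a fin_num.
  apply: integrable_fin_num => //; apply: bounded_integrable.
    exact: (continuous_measurable_fun (@continuous_cutoff x 1)).
  exact: cutoff_bounded.
move: enu; rewrite -(fineK nu_fin) lte_fin => enu.
move=> /(_ _ (@nbhs_open_ereal_gt _ _ (cst e) enu))[k0 _ /= emu].
have mu_antiS i j y : (i <= j)%N ->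
    mu j `]-oo, y]%classic <= mu i `]-oo, y]%classic.
  move=> /subnK <-; elim: (j - i)%N => // d IH.
  by rewrite addSn (le_trans _ IH).
apply: (lt_le_trans (emu (maxn k k0) (leq_maxr _ _))).
by apply: le_trans (int_le _) _; apply: mu_antiS; exact: leq_maxl.
Qed.

End cutoff.

(** * Functions of finitely many letters *)

Section words.
Context {R : realType}.
Implicit Types w : Omega R.

Definition same_prefix m (w w' : nat -> nat) :=
  forall i, (i < m)%N -> w i = w' i.

(** Distances between distinct words are powers 2^-p, with p the length of the
    common prefix; being strictly below 2^-m forces p > m. *)
Lemma ball_same_prefix m w w' : ball w (2 ^- m : R) w' -> same_prefix m.+1 w w'.
Proof.
rewrite ballEmdist /= /mdist /= /word_dist.
case: pselect => [ww'|ww'].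
  case: ex_minnP => p _ p_min; rewrite ltf_pV2 ?posrE ?exprn_gt0//.
  rewrite ltr_eXn2l ?ltr1n// => mp i im; apply/eqP/negPn/negP => /p_min.
  by rewrite leqNgt (leq_trans im mp).
by move=> _ i _; apply/eqP/negPn/negP => wi; apply: ww'; exists i.
Qed.

Lemma open_prefix m w : open [set w' : Omega R | same_prefix m w w'].
Proof.
rewrite openE => w1 /= ww1; apply/nbhs_ballP; exists (2 ^- m) => /=.
  by rewrite invr_gt0 exprn_gt0.
move=> w2 /ball_same_prefix w12 i im; rewrite ww1// w12//; exact: ltnW.
Qed.

(** Such a function is locally constant, so that all its preimages are open. *)
Lemma measurable_prefix_dependent d (T : measurableType d) m
    (f : borel (Omega R) -> T) :
  (forall w w', same_prefix m w w' -> f w = f w') -> measurable_fun setT f.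
Proof.
move=> fm mT Y mY; rewrite setTI; apply: sub_sigma_algebra => /=.
rewrite (_ : f @^-1` Y =
    \bigcup_(w in f @^-1` Y) [set w' : Omega R | same_prefix m w w']).
  by apply: bigcup_open => w _; exact: open_prefix.
apply/seteqP; split=> [w Yw|w [w' Yw' ww']]; first by exists w.
by rewrite /preimage/= -(fm _ _ ww').
Qed.

Lemma partial_conv_prefix (N : nat -> R) (B : nat -> {fset R}) n k w w' :
  same_prefix k.+1 w w' -> partial_conv N B n w k = partial_conv N B n w' k.
Proof.
have factor j : same_prefix j.+1 w w' ->
    conv_factor N B n w j = conv_factor N B n w' j.
  move=> ww'; rewrite /conv_factor (ww' j)//.
  by rewrite (eq_bigr (fun i : 'I_j.+1 => N (w' i) ^- n i))// => i _;
     rewrite ww'.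
elim: k => [|k IH] ww' /=; first exact: factor.
rewrite IH ?factor// => i ik; apply: ww'; exact: ltnW.
Qed.

End words.

(** * The infinite convolution as a random measure *)

Lemma infconvP (R : realType) (N : nat -> R) (B : nat -> {fset R}) n
    (w : Omega R) :
  infconv_exists N B n w -> weak_cvg (partial_conv N B n w) (infconv N B n w).
Proof. by move=> /getPex. Qed.

(** Existence for the exponents 1 passes to larger exponents: monotonicity holds
    for both, and the absence of escaping mass is inherited from the
    exponents 1. *)
Lemma infconv_existsW (R : realType) (N : nat -> R) (B : nat -> {fset R})
    (hN : forall k, 2 <= N k) (hB : forall k, B k <> fset0)
    (hB0 : forall k b, b \in B k -> 0 <= b) (n : nat -> nat) (w : Omega R) :
  (forall k, (0 < n k)%N) ->
  infconv_exists N B (fun=> 1%N) w -> infconv_exists N B n w.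
Proof.
move=> n0 [nu wnu]; apply: weak_cvg_monotone.
- by move=> k; exact: partial_conv_setT.
- by move=> k x; exact: partial_conv_ray_anti.
- move=> e e1; have [|x ex] := weak_cvg_ray_tight wnu _ e1.
    by move=> k x; exact: partial_conv_ray_anti.
  by exists x => k; apply: lt_le_trans (ex k) _; exact: partial_conv_ray_le.
Qed.

(** The rays are stable under intersection and generate the Borel sets, and the
    sets A on which the claim holds are stable under complements and countable
    disjoint unions. *)
Lemma measurable_probability_rays d (W : measurableType d) (R : realType)
    (M : W -> probability R R) :
  (forall x : R, measurable_fun setT (fun w => M w `]-oo, x]%classic)) ->
  forall A, measurable A -> measurable_fun setT (fun w => M w A).
Proof.
move=> Mx A mA; have : <<s rays >> A by rewrite -measurable_raysE.
move: A {mA}; apply: (@dynkin_induction _ _ (@rays R)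
  [set A | measurable_fun setT (fun w => M w A)]
  measurable_raysE (@setI_closed_rays R)) => /=.
- under eq_fun do rewrite probability_setT; exact: measurable_cst.
- by move=> _ [x ->]; exact: Mx.
- move=> S mS MS; under eq_fun do rewrite probability_setC//.
  by apply: emeasurable_funB => //; exact: measurable_cst.
- move=> F mF tF MF.
  apply: (emeasurable_fun_cvg (fun k w => \sum_(0 <= i < k) M w (F i))%E).
    by move=> k; exact: emeasurable_sum.
  by move=> w _; apply: measure_sigma_additive.
Qed.

(** Both limits, in the order k of the partial convolution and in the slope m of
    the cutoff, are pointwise in the word, hence preserve measurability. *)
Lemma measurable_infconv (R : realType) (N : nat -> R) (B : nat -> {fset R}) n :
  (forall w : Omega R, infconv_exists N B n w) ->
  forall A, measurable A ->
    measurable_fun setT (fun w : borel (Omega R) => infconv N B n w A).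
Proof.
move=> ex; apply: measurable_probability_rays => x.
apply: (emeasurable_fun_cvg
  (fun m (w : borel (Omega R)) => \int[infconv N B n w]_t (cutoff x m t)%:E)%E).
  move=> m; apply: (emeasurable_fun_cvg
    (fun k (w : borel (Omega R)) =>
      \int[partial_conv N B n w k]_t (cutoff x m t)%:E)%E).
    move=> k; apply: (measurable_prefix_dependent (m := k.+1)) => w w' ww'.
    by rewrite (partial_conv_prefix _ _ _ ww').
  move=> w _; apply: (infconvP (ex w)); first exact: continuous_cutoff.
  exact: cutoff_bounded.
by move=> w _; exact: cvg_integral_cutoff.
Qed.

Theorem theorem1p2 (R : realType) (N : nat -> R) (B : nat -> {fset R})
    (hN : forall k, 2 <= N k)
    (hB : forall k, B k <> fset0)
    (hB0 : forall k b, b \in B k -> 0 <= b)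
    (hmu : forall w : Omega R, infconv_exists N B (fun=> 1%N) w)
    (htight : tight [set infconv N B (fun=> 1%N) w | w in [set: Omega R]]) :
  forall n : nat -> nat, (forall k, (0 < n k)%N) ->
    (forall w : Omega R, infconv_exists N B n w) /\
    random_measure
      (fun (w : borel (Omega R)) (A : set R) => infconv N B n w A).
Proof.
move=> n n0.
have ex (w : Omega R) : infconv_exists N B n w.
  by apply: infconv_existsW => //; exact: hmu.
split=> //; split; first exact: measurable_infconv.
by move=> w; exists (infconv N B n w).
Qed.
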